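(* Let $A(\cdot)=(A(n))_{n\in\mathbb{N}}$ be a Lyapunov sequence of matrices in $\mathbb{R}^{s\times s}$, and suppose that the system $x(n+1)=A(n)x(n)$, $n\in\mathbb{N}$, $x\in\mathbb{R}^s$, has a splitted fundamental system of solutions $\{x_1(\cdot),\dots,x_s(\cdot)\}$. Then there exist $\beta>0$ and $\delta>0$ such that for any $\xi_i\in[-\delta,\delta]$, $i=1,\dots,s$, there exists an admissible multiplicative perturbation $R(\cdot)$ (i.e. a Lyapunov sequence $R:\mathbb{N}\to\mathbb{R}^{s\times s}$) satisfying the estimate $$\|R-I\|_\infty\le\beta\max\{|\xi_i|: i=1,\dots,s\}$$ and such that the solutions $\overline{x}_i(\cdot)$, $i=1,\dots,s$, of the system $x(n+1)=A(n)R(n)x(n)$, $n\in\mathbb{N}$, with the initial conditions $\overline{x}_i(1)=x_i(1)$, $i=1,\dots,s$, satisfy $$\lambda[\overline{x}_i]=\lambda[x_i]+\xi_i,\quad i=1,\dots,s.$$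
   Context: $\mathbb{N}=\{1,2,\dots\}$. $\mathbb{R}^s$ carries the Euclidean norm and $\mathbb{R}^{s\times s}$ the corresponding operator (spectral) norm; $I$ is the identity matrix. For a sequence $F(\cdot)=(F(n))_{n\in\mathbb{N}}$ of matrices, $\|F\|_\infty=\sup_{n\in\mathbb{N}}\|F(n)\|$; in particular $\|R-I\|_\infty=\sup_n\|R(n)-I\|$. A Lyapunov sequence is a bounded sequence of invertible matrices $L(n)\in\mathbb{R}^{s\times s}$, $n\in\mathbb{N}$, whose sequence of inverses $L^{-1}(n)$ is also bounded. A fundamental system of solutions (FSS) is a set of $s$ linearly independent solutions (defined on $\mathbb{N}$). The Lyapunov exponent of a nontrivial solution $x(\cdot)$ is $\lambda[x]=\limsup_{n\to\infty}\frac1n\ln\|x(n)\|$. The angle between nonzero vectors is $\sphericalangle(p,q)=\arccos\frac{\langle p,q\rangle}{\|p\|\|q\|}$, and the angle between a nonzero vector $p$ and a linear subspace $V$ is $\sphericalangle(p;V)=\inf_{0\ne q\in V}\sphericalangle(p,q)$ (for $V=\{0\}$, which occurs below only when $s=1$, the infimum is read as $+\infty$). Broken away solutions and splitted FSS. Let $\{x_1(\cdot),\dots,x_s(\cdot)\}$ be an FSS. For $i\in\{1,\dots,s\}$ and $n\in\mathbb{N}$ let $V_i(n)$ be the linear span of the vectors $x_j(n)$, $j\ne i$, and let $\varphi_i(n)=\sphericalangle(x_i(n);V_i(n))$. For $\sigma\in\mathbb{N}$, $\gamma\in(0,\frac{\pi}{2}]$, $k\in\mathbb{N}$, let $N_i^\gamma(k;\sigma)$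 be the number of $j\in\{1,\dots,k\}$ with $\varphi_i(j\sigma)\ge\gamma$, and let $g_i^\gamma(k;\sigma)=N_i^\gamma(k;\sigma)/k$. A realizing sequence of a solution $x(\cdot)$ is a strictly increasing sequence $(n_k)_{k\in\mathbb{N}}$ of natural numbers tending to $+\infty$ with $\lambda[x]=\lim_{k\to\infty}\frac{\ln\|x(n_k)\|}{n_k}$. The solution $x_i(\cdot)$ of the FSS is called $\sigma$-broken away if there exist $\gamma\in(0,\frac{\pi}{2}]$ and a realizing sequence of $x_i(\cdot)$ of the form $(k_n\sigma)_{n\in\mathbb{N}}$, $k_n\in\mathbb{N}$, such that the limit $\lim_{n\to\infty}g_i^\gamma(k_n;\sigma)$ exists and is positive. The FSS is $\sigma$-splitted if each of its solutions is $\sigma$-broken away, and it is called splitted if it is $\sigma$-splitted for some $\sigma\in\mathbb{N}$. *)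

(* Defs.v *)
From HB Require Import structures.
From mathcomp Require Import all_boot all_order all_algebra.
From mathcomp Require Import all_classical all_reals all_analysis.

Set Implicit Arguments.
Unset Strict Implicit.
Unset Printing Implicit Defensive.

Import Order.TTheory GRing.Theory Num.Theory.
Import numFieldNormedType.Exports.

Local Open Scope classical_set_scope.
Local Open Scope ring_scope.

(* Throughout, N = {1, 2, ...}: a sequence indexed by N is a function on nat
   whose value at 0 is never constrained. *)

Section Norms.
Context {R : realType} {s : nat}.
Implicit Types (p q v : 'cV[R]_s) (A : 'M[R]_s) (F : nat -> 'M[R]_s).

(* The norm that MathComp-Analysis puts on matrices is the maximum of the
   absolute values of the entries, hence the Euclidean and spectral norms
   below. *)
Definition dotv p q : R := \sum_(i < s) p i 0 * q i 0.

Definition enorm v : R := Num.sqrt (dotv v v).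

Definition opnorm A : R :=
  sup [set enorm (A *m v) | v in [set v | enorm v <= 1]].

Definition norm_infty F : \bar R :=
  ereal_sup [set (opnorm (F n))%:E | n in [set n | (0 < n)%N]].

Definition lyapunov_sequence F : Prop :=
  [/\ forall n, (0 < n)%N -> F n \in unitmx,
      (norm_infty F < +oo)%E
    & (norm_infty (fun n => invmx (F n)) < +oo)%E].

End Norms.

Section Systems.
Context {R : realType} {s : nat}.
Implicit Types (A : nat -> 'M[R]_s) (x : nat -> 'cV[R]_s).

Definition solution A x : Prop :=
  forall n, (0 < n)%N -> x n.+1 = A n *m x n.

Definition is_FSS A (X : 'I_s -> nat -> 'cV[R]_s) : Prop :=
  (forall i, solution A (X i)) /\
  (forall c : 'I_s -> R,
     (forall n, (0 < n)%N -> \sum_(i < s) c i *: X i n = 0) ->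
     forall i, c i = 0).

Definition lyapunov_exponent x : \bar R :=
  limn_esup (fun n => (n%:R^-1 * ln (enorm (x n)))%:E).

Definition realizing_sequence x (m : nat -> nat) : Prop :=
  [/\ forall k, (0 < k)%N -> (0 < m k)%N,
      forall k, (0 < k)%N -> (m k < m k.+1)%N,
      m k @[k --> \oo] --> \oo
    & (ln (enorm (x (m k))) / (m k)%:R)%:E @[k --> \oo]
        --> lyapunov_exponent x].

End Systems.

Section Splitted.
Context {R : realType} {s : nat}.
Implicit Types (p q : 'cV[R]_s) (V : {vspace 'cV[R]_s}).
Implicit Types (X : 'I_s -> nat -> 'cV[R]_s) (i : 'I_s).

Definition angle p q : R := acos (dotv p q / (enorm p * enorm q)).

(* The extended infimum gives +oo when V = 0. *)
Definition angle_subspace p V : \bar R :=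
  ereal_inf [set (angle p q)%:E | q in [set q | q != 0 /\ q \in V]].

Definition span_others X i (n : nat) : {vspace 'cV[R]_s} :=
  (\sum_(j < s | j != i) <[X j n]>)%VS.

Definition phi X i (n : nat) : \bar R :=
  angle_subspace (X i n) (span_others X i n).

Definition Ncount X i (gamma : R) (k sigma : nat) : nat :=
  count (fun j => (gamma%:E <= phi X i (j * sigma))%E) (iota 1 k).

Definition gfreq X i (gamma : R) (k sigma : nat) : R :=
  (Ncount X i gamma k sigma)%:R / k%:R.

Definition broken_away (sigma : nat) X i : Prop :=
  exists gamma : R, exists k : nat -> nat, exists l : R,
    [/\ 0 < gamma <= pi / 2,
        realizing_sequence (X i) (fun n => (k n * sigma)%N),
        gfreq X i gamma (k n) sigma @[n --> \oo] --> l
      & 0 < l].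

Definition sigma_splitted (sigma : nat) X : Prop :=
  forall i, broken_away sigma X i.

Definition splitted X : Prop :=
  exists2 sigma : nat, (0 < sigma)%N & sigma_splitted sigma X.

End Splitted.

(* Main.v *)
Require Import Defs.
From HB Require Import structures.
From mathcomp Require Import all_boot all_order all_algebra.
From mathcomp Require Import all_classical all_reals all_analysis.
From mathcomp Require Import ring lra.

Set Implicit Arguments.
Unset Strict Implicit.
Unset Printing Implicit Defensive.

Import Order.TTheory GRing.Theory Num.Theory.
Import numFieldNormedType.Exports.

Local Open Scope classical_set_scope.
Local Open Scope ring_scope.

(** The perturbation multiplies the component along [x i] by a positive scalar
    at each step, so that [xbar i] is a scalar multiple of [x i].  All components
    are damped by [exp (- M)], [M = max |xi i|], which lowers every exponent by
    exactly [M]; it remains to raise the [i]-th exponent by [xi i + M >= 0].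
    (Lowering the exponents separately would fail: [x i] may realize its exponent
    along another sequence at which the times of large angle have density 0.)
    To raise it, the [i]-th component is multiplied by [exp eta] at the times
    where [x i] makes an angle at least [gamma] with the other solutions, so that
    the projection onto [x i] has norm at most [1 / sin gamma].  These times have
    positive density along a realizing sequence, hence the exponent grows at least
    linearly in [eta]; being Lipschitz in [eta], it reaches the required value. *)

Lemma expR_sub1_le {R : realType} (t : R) : expR t - 1 <= t * expR t.
Proof.
have := expR_ge1Dx (- t); rewrite expRN => h.
have := expR_gt0 t => e0; have := mulVf (lt0r_neq0 e0); nra.
Qed.

Lemma sin_gt0_pihalf {R : realType} (gamma : R) :
  0 < gamma <= pi / 2 -> 0 < sin gamma.
Proof.
move=> /andP[g0 gpi]; rewrite sin_gt0_pi// g0/= (le_lt_trans gpi)//.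
by rewrite ltr_pdivrMr// ltr_pMr ?pi_gt0// ltr1n.
Qed.

Lemma cvg_invn {R : realType} (m : nat -> nat) : m k @[k --> \oo] --> \oo ->
  (m k)%:R^-1 @[k --> \oo] --> (0 : R).
Proof.
move=> moo; apply/(@gtr0_cvgV0 _ _ _ _ (fun k => (m k)%:R)); last exact/cvgrnyP.
have : \forall k \near \oo, (0 < m k)%N.
  by move/cvgnyPgt : moo => /(_ 0%N).
by apply: filterS => k; rewrite ltr0n.
Qed.

(** * Euclidean norm, angles and the operator norm *)

Section Euclid.
Context {R : realType} {s : nat}.
Implicit Types (p q v w : 'cV[R]_s) (a c : R).

Lemma dotvC p q : dotv p q = dotv q p.
Proof. by apply: eq_bigr => i _; rewrite mulrC. Qed.

Lemma dotvDl p q v : dotv (p + q) v = dotv p v + dotv q v.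
Proof. by rewrite -big_split; apply: eq_bigr => i _; rewrite mxE mulrDl. Qed.

Lemma dotvZl a p v : dotv (a *: p) v = a * dotv p v.
Proof. by rewrite mulr_sumr; apply: eq_bigr => i _; rewrite mxE mulrA. Qed.

Lemma dotvDr p q v : dotv v (p + q) = dotv v p + dotv v q.
Proof. by rewrite !(dotvC v) dotvDl. Qed.

Lemma dotvZr a p v : dotv v (a *: p) = a * dotv v p.
Proof. by rewrite !(dotvC v) dotvZl. Qed.

Lemma dotv_ge0 v : 0 <= dotv v v.
Proof. by apply: sumr_ge0 => i _; rewrite -expr2 sqr_ge0. Qed.

Lemma dotv_eq0 v : (dotv v v == 0) = (v == 0).
Proof.
apply/idP/eqP => [|->]; last by rewrite /dotv big1// => i _; rewrite mxE mul0r.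
rewrite psumr_eq0 => [/allP h|i _]; last by rewrite -expr2 sqr_ge0.
apply/colP => i; rewrite mxE; apply/eqP.
by have := h i (mem_index_enum i); rewrite /= mulf_eq0 orbb.
Qed.

Lemma enorm_ge0 v : 0 <= enorm v.
Proof. exact: sqrtr_ge0. Qed.

Lemma sqr_enorm v : enorm v ^+ 2 = dotv v v.
Proof. exact/sqr_sqrtr/dotv_ge0. Qed.

Lemma enorm_eq0 v : (enorm v == 0) = (v == 0).
Proof. by rewrite -dotv_eq0 -sqr_enorm sqrf_eq0. Qed.

Lemma enorm_gt0 v : (0 < enorm v) = (v != 0).
Proof. by rewrite lt_neqAle enorm_ge0 andbT eq_sym enorm_eq0. Qed.

Lemma enorm0 : enorm (0 : 'cV[R]_s) = 0.
Proof. by apply/eqP; rewrite enorm_eq0. Qed.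

Lemma enormZ a v : enorm (a *: v) = `|a| * enorm v.
Proof.
by rewrite /enorm dotvZl dotvZr mulrA -expr2 sqrtrM ?sqr_ge0// sqrtr_sqr.
Qed.

Lemma dotv_le_enorm p q : `|dotv p q| <= enorm p * enorm q.
Proof.
rewrite -ler_sqr ?nnegrE ?mulr_ge0 ?enorm_ge0 ?normr_ge0//.
rewrite real_normK ?num_real//.
rewrite exprMn !sqr_enorm; have [->|q0] := eqVneq q 0.
  by rewrite dotvC -(scale0r 0) !dotvZl !mul0r expr0n mulr0.
have q2 : 0 < dotv q q by rewrite lt_neqAle dotv_ge0 eq_sym dotv_eq0 q0.
(* This vector is [dotv q q] times the part of [p] orthogonal to [q]. *)
have := dotv_ge0 (dotv q q *: p + (- dotv p q) *: q).
rewrite !(dotvDl, dotvDr, dotvZl, dotvZr) (dotvC q p).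
by move=> h; rewrite -subr_ge0 -(pmulr_rge0 _ q2); nra.
Qed.

Lemma enormD p q : enorm (p + q) <= enorm p + enorm q.
Proof.
rewrite -ler_sqr ?nnegrE ?addr_ge0 ?enorm_ge0//.
rewrite sqrrD !sqr_enorm !(dotvDl, dotvDr) (dotvC q p).
have := le_trans (ler_norm _) (dotv_le_enorm p q); lra.
Qed.

Lemma enorm_sum (F : 'I_s -> 'cV[R]_s) :
  enorm (\sum_i F i) <= \sum_i enorm (F i).
Proof.
elim/big_ind2 : _ => [|v a w b va wb|//]; first by rewrite enorm0.
by rewrite (le_trans (enormD _ _))// lerD.
Qed.

(** Once [dotv p q <= cos gamma * |p| * |q|], the square of [enorm (p - q)] is at least [(|q| - cos
    gamma * |p|)^2 + (sin gamma * |p|)^2]. *)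
Lemma angle_sin_le p q (gamma : R) : 0 < gamma <= pi / 2 ->
    (p != 0 -> q != 0 -> gamma <= angle p q) ->
  sin gamma * enorm p <= enorm (p - q).
Proof.
move=> gI hangle; have sin_g := ltW (sin_gt0_pihalf gI).
have {gI} gI : gamma \in `[0, pi].
  have /andP[g0 gpi] := gI; rewrite in_itv/= ltW//= (le_trans gpi)//.
  by rewrite ler_pdivrMr// ler_peMr ?pi_ge0// ler1n.
have [->|p0] := eqVneq p 0; first by rewrite enorm0 mulr0 enorm_ge0.
have [->|q0] := eqVneq q 0.
  by rewrite subr0 ler_piMl ?enorm_ge0 ?sin_le1.
have {hangle} := hangle p0 q0; rewrite /angle; set t := _ / _ => gt.
have pq0 : 0 < enorm p * enorm q by rewrite mulr_gt0 ?enorm_gt0.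
have tI : -1 <= t <= 1.
  rewrite -ler_norml normrM normfV (gtr0_norm pq0) ler_pdivrMr// mul1r.
  exact: dotv_le_enorm.
have tcos : t <= cos gamma.
  rewrite -[t]acosK ?in_itv//= leNgt; apply/negP => lt_cos.
  move: gt; rewrite leNgt => /negP; apply.
  rewrite -ltr_cos// in_itv/= acos_ge0//= acos_lepi//.
have {}tcos : dotv p q <= cos gamma * (enorm p * enorm q).
  by rewrite -ler_pdivrMr.
rewrite -ler_sqr ?nnegrE ?mulr_ge0 ?enorm_ge0// exprMn.
rewrite [enorm (p - q) ^+ 2]sqr_enorm.
rewrite -scaleN1r !(dotvDl, dotvDr, dotvZl, dotvZr) (dotvC q p) -!sqr_enorm.
have := sqr_ge0 (enorm q - cos gamma * enorm p).
rewrite sin2cos2; nra.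
Qed.

(** Bounds the component along [p] of a vector split along [p] and [V]: dividing by [a] leaves [p]
    minus a vector of [V]. *)
Lemma angle_subspace_sin_le p w (V : {vspace 'cV[R]_s}) (gamma a : R) :
    0 < gamma <= pi / 2 -> (gamma%:E <= angle_subspace p V)%E -> w \in V ->
  sin gamma * enorm (a *: p) <= enorm (a *: p + w).
Proof.
move=> gI gV wV; have [->|a0] := eqVneq a 0.
  by rewrite scale0r enorm0 mulr0 enorm_ge0.
have -> : a *: p + w = a *: (p - (- a^-1) *: w).
  by rewrite scaleNr opprK scalerDr scalerA mulfV// scale1r.
rewrite !enormZ mulrCA ler_pM2l ?normr_gt0//; apply: angle_sin_le => // p0 q0.
rewrite -lee_fin (le_trans gV)//; apply: ereal_inf_lbound.
by exists (- a^-1 *: w) => //=; split=> //; rewrite memvZ.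
Qed.

Lemma opnorm_le (F : 'M[R]_s) c : 0 <= c ->
  (forall v, enorm (F *m v) <= c * enorm v) -> opnorm F <= c.
Proof.
move=> c0 Fc; apply: ge_sup.
  by exists (enorm (F *m 0)), 0 => //=; rewrite enorm0.
by move=> _ [v /= v1 <-]; rewrite (le_trans (Fc v))// ler_piMr.
Qed.

Lemma norm_infty_le (F : nat -> 'M[R]_s) c : 0 <= c ->
  (forall n v, (0 < n)%N -> enorm (F n *m v) <= c * enorm v) ->
  (norm_infty F <= c%:E)%E.
Proof.
move=> c0 Fc; apply: ge_ereal_sup => _ [n /= n0 <-].
by rewrite lee_fin opnorm_le// => v; exact: Fc.
Qed.

End Euclid.

(** * Upper limits under bounded and parametrized shifts *)

Section Limsup.
Context {R : realType}.
Implicit Types (u v f h w : nat -> R) (m : nat -> nat) (c : R).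

Lemma limn_esup_le u v c :
    (forall e, 0 < e -> \forall n \near \oo, u n <= v n + (c + e)) ->
  (limn_esup (fun n => (u n)%:E) <= limn_esup (fun n => (v n)%:E) + c%:E)%E.
Proof.
move=> uv; apply/lee_addgt0Pr => e e0.
rewrite -addeA -EFinD -leeBlDr//; apply: le_ereal_inf_tmp => _ [V Voo <-].
(* [limn_esup] is an infimum of suprema over the neighbourhoods of infinity, so [V] may be shrunk to
   where the hypothesis holds. *)
rewrite leeBlDr//; pose W := V `&` [set n | u n <= v n + (c + e)].
apply: (@le_trans _ _ (ereal_sup [set (u n)%:E | n in W])).
  by apply: ereal_inf_lbound; exists W => //; apply: filterI => //; exact: uv.
apply: ge_ereal_sup => _ [n [Vn /= un] <-].
apply: (@le_trans _ _ ((v n)%:E + (c + e)%:E)%E); first by rewrite -EFinD lee_fin.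
by rewrite leeD2r//; apply: ereal_sup_ubound; exists n.
Qed.

Lemma limn_esup_eq u v c : u n - v n @[n --> \oo] --> c ->
  limn_esup (fun n => (u n)%:E) = (limn_esup (fun n => (v n)%:E) + c%:E)%E.
Proof.
move=> uvc; apply/eqP; rewrite eq_le limn_esup_le => [|e e0]/=; last first.
  move/cvgrPdist_le : uvc => /(_ e e0); apply: filterS => n.
  by rewrite ler_norml => /andP[]; lra.
rewrite -leeBrDr// -EFinN; apply: limn_esup_le => e e0.
move/cvgrPdist_le : uvc => /(_ e e0); apply: filterS => n.
by rewrite ler_norml => /andP[]; lra.
Qed.

(* The exponent of [f + eta * h] is a Lipschitz function of [eta] which grows at
   least as fast as [eta * a], so it takes the value [limsup f + zeta]. *)
Lemma limn_esup_shift f h w m (a zeta : R) :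
    (forall n, 0 <= h n <= 1) -> m k @[k --> \oo] --> \oo ->
    (f (m k))%:E @[k --> \oo] --> limn_esup (fun n => (f n)%:E) ->
    (forall k, w k <= h (m k)) -> w k @[k --> \oo] --> a ->
    0 < a -> 0 <= zeta ->
  exists2 eta, 0 <= eta <= zeta / a &
    limn_esup (fun n => (f n + eta * h n)%:E)
    = (limn_esup (fun n => (f n)%:E) + zeta%:E)%E.
Proof.
move=> h01 moo fm wh wa a0 z0.
pose G eta := limn_esup (fun n => (f n + eta * h n)%:E).
have Glip x y : (G x <= G y + `|x - y|%:E)%E.
  apply: limn_esup_le => e e0; apply: nearW => n.
  have /andP[h0 h1] := h01 n.
  have : (x - y) * h n <= `|x - y|.
    rewrite (le_trans (ler_norm _))// normrM (ger0_norm h0) ler_piMr//.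
  lra.
have G0 : G 0 = limn_esup (fun n => (f n)%:E).
  by congr limn_esup; apply/funext => n; rewrite mul0r addr0.
have za0 : 0 <= zeta / a by rewrite divr_ge0// ltW.
rewrite -G0; move: G0 Glip; rewrite -/(G _).
(* If the upper limit of [f] is infinite, adding [zeta] does not change it and [eta = 0] serves. *)
case EG : (G 0) => [L| |] G0 Glip; last 2 first.
- exists 0; first by rewrite lexx.
  by rewrite -/(G 0) EG.
- exists 0; first by rewrite lexx.
  by rewrite -/(G 0) EG.
have Gfin x : G x \is a fin_num.
  rewrite fin_numElt; apply/andP; split.
    have := Glip 0 x; rewrite EG ltNye; case: (G x) => //.
  have := Glip x 0; rewrite EG -EFinD; case: (G x) => // r _; exact: ltry.
pose g x := fine (G x).
have gE x : G x = (g x)%:E by rewrite /g fineK.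
have glip x y : g x <= g y + `|x - y|.
  by have := Glip x y; rewrite !gE -EFinD lee_fin.
have gcont : continuous g.
  move=> x; apply/cvgrPdist_le => e e0; near=> y.
  have xy : `|x - y| <= e by near: y; exact: cvgr_dist_le.
  have := glip x y; have := glip y x; rewrite distrC => h1 h2.
  rewrite (le_trans _ xy)// ler_norml; apply/andP; split; lra.
(* At the times [m k] one has [f + zeta / a * h >= f + zeta / a * w], and the right side tends to
   [L + zeta / a * a]. *)
have gup : L + zeta <= g (zeta / a).
  rewrite -lee_fin -gE; move: fm; rewrite -G0 => fm.
  have fwa : f (m k) + zeta / a * w k @[k --> \oo] --> L + zeta.
    rewrite -[X in L + X](divfK (lt0r_neq0 a0)); apply: cvgD; last exact: cvgMl_tmp.
    exact: (fine_cvg fm).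
  have G_ge e : 0 < e -> L + zeta - e <= g (zeta / a).
    move=> e0; rewrite -lee_fin -gE.
    apply: le_ereal_inf_tmp => _ [V Voo <-].
    have mV : \forall k \near \oo, V (m k) by exact: moo.
    have fe : \forall k \near \oo, L + zeta - e <= f (m k) + zeta / a * w k.
      by apply: (cvgr_ge _ fwa); rewrite ltrBlDr ltrDl.
    have [k [Vk fk]] := filter_ex (filterI mV fe).
    apply: (@le_trans _ _ (f (m k) + zeta / a * h (m k))%:E).
      by rewrite lee_fin (le_trans fk)// lerD2l ler_wpM2l.
    by apply: ereal_sup_ubound; exists (m k).
  by rewrite gE lee_fin; apply/ler_addgt0Pr => e /G_ge; rewrite lerBlDr.
have [//|||eta etaI geta] := @IVT R g 0 (zeta / a) (L + zeta).
- exact/continuous_subspaceT.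
- have -> : g 0 = L by rewrite /g EG.
  by rewrite ge_min lerDl z0/= le_max gup orbT.
exists eta; first by move: etaI; rewrite in_itv.
by rewrite -/(G eta) gE geta.
Unshelve. all: by end_near. Qed.

End Limsup.

(** * Matrices diagonal in the basis of the solutions *)

Section Eigenbasis.
Context {R : realType} {s : nat}.
Implicit Types (Y : 'M[R]_s) (D : 'I_s -> R) (v : 'cV[R]_s).
Implicit Types (x : 'I_s -> nat -> 'cV[R]_s).

(** With [Y = fundmx x n], each [x j n] is an eigenvector, so a perturbation of this form rescales
    the given solutions without changing their directions. *)
Definition eigenmx Y D : 'M[R]_s := Y *m diag_mx (\row_j D j) *m invmx Y.

Lemma mulmx_sum_colr Y v : Y *m v = \sum_j v j 0 *: col j Y.
Proof.
apply/colP => i; rewrite mxE summxE; apply: eq_bigr => j _.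
by rewrite !mxE mulrC.
Qed.

Lemma eigenmx_mul Y D v :
  eigenmx Y D *m v = \sum_j (D j * (invmx Y *m v) j 0) *: col j Y.
Proof.
rewrite /eigenmx -!mulmxA mulmx_sum_colr; apply: eq_bigr => j _.
by rewrite mul_diag_mx !mxE.
Qed.

Lemma eigenmx_col Y D i : Y \in unitmx ->
  eigenmx Y D *m col i Y = D i *: col i Y.
Proof.
move=> Yu; rewrite eigenmx_mul (bigD1 i)//= big1 => [|j ji].
  by rewrite colE mulKmx// mxE !eqxx mulr1 addr0.
by rewrite colE mulKmx// mxE (negbTE ji) mulr0 scale0r.
Qed.

Lemma eigenmxV Y D : Y \in unitmx -> (forall j, D j != 0) ->
  eigenmx Y D \in unitmx /\
  invmx (eigenmx Y D) = eigenmx Y (fun j => (D j)^-1).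
Proof.
move=> Yu D0.
have DV : eigenmx Y D *m eigenmx Y (fun j => (D j)^-1) = 1%:M.
  rewrite /eigenmx !mulmxA mulmxKV// -(mulmxA Y) mulmx_diag.
  rewrite (_ : \row_j _ = const_mx 1) ?diag_const_mx ?mulmx1 ?mulmxV//.
  by apply/rowP => j; rewrite !mxE divff.
have [Eu _] := mulmx1_unit DV; split=> //.
by rewrite -[RHS](mulKmx Eu) DV mulmx1.
Qed.

Definition fundmx x n : 'M[R]_s := \matrix_(k, j) x j n k 0.

Lemma col_fundmx x n j : col j (fundmx x n) = x j n.
Proof. by apply/colP => i; rewrite !mxE. Qed.

(** Independence is assumed for whole sequences: a relation at time 1 would spread to all times by
    the recursion. Invertibility at time 1 is then carried on by the factors [A n]. *)
Lemma fundmx_unit (A : nat -> 'M[R]_s) x n :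
  (forall n, (0 < n)%N -> A n \in unitmx) -> is_FSS A x -> (0 < n)%N ->
  fundmx x n \in unitmx.
Proof.
move=> Au [xsol xind].
have fundS k : (0 < k)%N -> fundmx x k.+1 = A k *m fundmx x k.
  move=> k0; apply/matrixP => i j; rewrite mxE xsol// -(col_fundmx x k).
  by rewrite !mxE; apply: eq_bigr => l _; rewrite !mxE.
case: n => // n _; elim: n => [|n IHn]; last by rewrite fundS// unitmx_mul Au.
rewrite -unitmx_tr unitmxE unitfE; apply/negP => /det0P[c c0 cx].
have {}cx : \sum_i c 0 i *: x i 1%N = 0.
  have := congr1 trmx cx; rewrite trmx_mul trmxK trmx0 mulmx_sum_colr => cx0.
  rewrite -[RHS]cx0.
  by apply: eq_bigr => i _; rewrite mxE col_fundmx.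
case/eqP: c0; apply/rowP => i; rewrite mxE; apply: xind => -[//|k] _.
elim: k => // k IHk.
rewrite (eq_bigr (fun i => A k.+1 *m (c 0 i *: x i k.+1))) => [|j _].
  by rewrite -mulmx_sumr IHk mulmx0.
by rewrite xsol// scalemxAr.
Qed.

(* The component of [v] along [x j n] has norm at most [enorm v / sin gamma]
   as soon as [x j n] makes an angle at least [gamma] with the other [x i n]. *)
Lemma eigenmx_dist x n D (c : R) (a gamma : 'I_s -> R) v :
    fundmx x n \in unitmx ->
    (forall j, 0 < gamma j <= pi / 2) ->
    (forall j, D j = c * (1 + a j)) ->
    (forall j, a j != 0 -> ((gamma j)%:E <= phi x j n)%E) ->
  enorm (eigenmx (fundmx x n) D *m v - c *: v)
    <= `|c| * (\sum_j `|a j| / sin (gamma j)) * enorm v.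
Proof.
move=> Yu gI Da aphi; set Y := fundmx x n; pose y := invmx Y *m v.
have vE : v = \sum_j y j 0 *: x j n.
  rewrite -[v](mulKVmx Yu) mulmx_sum_colr.
  by apply: eq_bigr => j _; rewrite col_fundmx.
have -> : eigenmx Y D *m v - c *: v = \sum_j (c * a j) *: (y j 0 *: x j n).
  rewrite eigenmx_mul [in X in _ - X]vE scaler_sumr -sumrB.
  apply: eq_bigr => j _; rewrite col_fundmx -/y Da !scalerA -scalerBl.
  by congr (_ *: _); ring.
rewrite (le_trans (enorm_sum _))// mulr_sumr mulr_suml; apply: ler_sum => j _.
rewrite enormZ normrM -!mulrA ler_wpM2l//.
have [->|aj0] := eqVneq (a j) 0; first by rewrite normr0 !mul0r.
rewrite ler_wpM2l//.
(* The remaining sum lies in [span_others x j n], so the angle bound controls the [j]-th term by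
   [v]. *)
rewrite ler_pdivlMl ?sin_gt0_pihalf// vE (bigD1 j)//=.
apply: (angle_subspace_sin_le _ (gI j) (aphi _ aj0)).
by apply: memv_sumr => i ij; rewrite memvZ// memv_line.
Qed.

End Eigenbasis.

(** * Frequency of the times of large angle and its effect on exponents *)

Lemma count_multiples_le (g : pred nat) (sigma k : nat) : (0 < sigma)%N ->
  (count (fun j => g (j * sigma)) (iota 1 k)
    <= (\sum_(1 <= m < k * sigma) g m).+1)%N.
Proof.
(* The sum omits the time [k * sigma], worth at most one. With that time included, each new block of
   [sigma] times ends at the next multiple. *)
move=> s0; suff : (count (fun j => g (j * sigma)) (iota 1 k)
    <= \sum_(1 <= m < (k * sigma).+1) g m)%N.
  move/leq_trans; apply; case: (posnP (k * sigma)) => [->|ks].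
    by rewrite !big_geq.
  by rewrite big_nat_recr//= -[leqRHS]addn1 leq_add2l leq_b1.
elim: k => // k IHk; rewrite -(addn1 k) iotaD count_cat/= addn0 add1n addn1.
rewrite big_nat_recr ?muln_gt0//= leq_add2r (leq_trans IHk)//.
rewrite [leqRHS](@big_cat_nat _ _ _ (k * sigma).+1) ?leq_addr//=.
by rewrite mulSn -add1n leq_add2r.
Qed.

Section Perturbation.
Context {R : realType} {s : nat}.
Implicit Types (x : 'I_s -> nat -> 'cV[R]_s) (gamma : R) (sigma : nat).

Definition good x i gamma sigma : pred nat :=
  fun m => (sigma %| m)%N && (gamma%:E <= phi x i m)%E.

(** A factor applied at time [m] first shows at time [m + 1], so the perturbed solution at time [n]
    has collected the good times [m < n]. *)
Definition ngood x i gamma sigma n : nat :=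
  \sum_(1 <= m < n) good x i gamma sigma m.

Lemma ngoodS x i gamma sigma n : (0 < n)%N ->
  ngood x i gamma sigma n.+1
    = (ngood x i gamma sigma n + good x i gamma sigma n)%N.
Proof. by move=> n0; rewrite /ngood big_nat_recr. Qed.

Lemma ngood_le x i gamma sigma n : (ngood x i gamma sigma n <= n)%N.
Proof.
case: n => [|n]; first by rewrite /ngood big_geq.
apply: (@leq_trans (\sum_(1 <= m < n.+1) 1)).
  by apply: leq_sum => m _; exact: leq_b1.
by rewrite sum_nat_const_nat muln1 subn1/=.
Qed.

(** Frequency [l] among the multiples of [sigma] is frequency [l / sigma] among all times. *)
Lemma exponent_shift sigma x i gamma (k : nat -> nat) (l zeta : R) :
    (0 < sigma)%N -> realizing_sequence (x i) (fun n => (k n * sigma)%N) ->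
    gfreq x i gamma (k n) sigma @[n --> \oo] --> l -> 0 < l -> 0 <= zeta ->
  exists2 eta, 0 <= eta <= zeta / (l / sigma%:R) &
    limn_esup (fun n => (n%:R^-1 * ln (enorm (x i n))
      + eta * ((ngood x i gamma sigma n)%:R / n%:R))%:E)
    = (lyapunov_exponent (x i) + zeta%:E)%E.
Proof.
move=> s0 [_ _ moo fm] gl l0 z0.
apply: (@limn_esup_shift _ _ _
  (* The subtracted inverse pays for the time [k n * sigma] itself, which [ngood] leaves out. *)
  (fun n => gfreq x i gamma (k n) sigma / sigma%:R - (k n * sigma)%:R^-1)
  (fun n => (k n * sigma)%N)) => //.
- case=> [|n]; first by rewrite invr0 mulr0 lexx ler01.
  by rewrite divr_ge0//= ler_pdivrMr// mul1r ler_nat ngood_le.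
- by under eq_fun do rewrite mulrC.
- move=> n; rewrite /gfreq -mulrA -invfM -natrM -[X in _ - X]mul1r -mulrBl.
  rewrite ler_wpM2r ?invr_ge0//.
  rewrite lerBlDr natr1 ler_nat.
  rewrite (leq_trans _ (count_multiples_le (good x i gamma sigma) _ s0))//.
  rewrite leq_eqVlt; apply/orP; left; apply/eqP/eq_count => j.
  by rewrite /good dvdn_mull.
- rewrite -[X in _ --> X]subr0; apply: cvgB; last exact: cvg_invn.
  exact: cvgMr_tmp.
- by rewrite divr_gt0// ltr0n.
Qed.

End Perturbation.

(** There are [n - 1] steps from time 1 to time [n], hence the damping [M - M * n]. Divided by [n]
    it tends to [- M], which cancels the [M] of the hypothesis. *)
Lemma exponent_scaled {R : realType} {s : nat} (x y : nat -> 'cV[R]_s)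
    (c : nat -> R) (M eta zeta : R) :
    (forall n, (0 < n)%N -> x n != 0) ->
    (forall n, (0 < n)%N -> y n = expR (M - M * n%:R + eta * c n) *: x n) ->
    limn_esup (fun n => (n%:R^-1 * ln (enorm (x n)) + eta * (c n / n%:R))%:E)
      = (lyapunov_exponent x + (zeta + M)%:E)%E ->
  lyapunov_exponent y = (lyapunov_exponent x + zeta%:E)%E.
Proof.
move=> x0 yE xM.
rewrite /lyapunov_exponent (@limn_esup_eq _ _ 
  (fun n => n%:R^-1 * ln (enorm (x n)) + eta * (c n / n%:R)) (- M)).
  by rewrite xM -addeA -EFinD addrK.
have : M * n%:R^-1 - M @[n --> \oo] --> - M.
  rewrite -[X in _ --> X]sub0r; apply: cvgB; last exact: cvg_cst.
  rewrite -(mulr0 M); apply: cvgMl_tmp; apply: cvg_invn; exact: cvg_id.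
apply: cvg_trans; apply: near_eq_cvg; near=> n.
have n0 : (0 < n)%N by near: n; exists 1%N.
have nR : n%:R != 0 :> R by rewrite pnatr_eq0 -lt0n.
rewrite yE// enormZ gtr0_norm ?expR_gt0// lnM ?posrE ?expR_gt0 ?enorm_gt0 ?x0//.
by rewrite expRK; field.
Unshelve. all: by end_near. Qed.

(** * Choice of the constants and construction of the perturbation *)

Theorem theorem5p1 (R : realType) (s : nat) (s_gt0 : (0 < s)%N)
    (A : nat -> 'M[R]_s) (x : 'I_s -> nat -> 'cV[R]_s)
    (hA : lyapunov_sequence A) (hx : is_FSS A x) (hsplit : splitted x) :
  exists beta delta : R, [/\ 0 < beta, 0 < delta &
    forall xi : 'I_s -> R, (forall i, - delta <= xi i <= delta) ->
    exists P : nat -> 'M[R]_s,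
      [/\ lyapunov_sequence P,
          (norm_infty (fun n => (P n - 1%:M)%R)
             <= (beta * \big[Num.max/0]_(i < s) `|xi i|)%:E)%E
        & forall xbar : 'I_s -> nat -> 'cV[R]_s,
            (forall i, solution (fun n => A n *m P n) (xbar i)
                       /\ xbar i 1%N = x i 1%N) ->
            forall i, lyapunov_exponent (xbar i)
                      = (lyapunov_exponent (x i) + (xi i)%:E)%E]].
Proof.
have [Au _ _] := hA.
have Yu n : (0 < n)%N -> fundmx x n \in unitmx by exact: fundmx_unit Au hx.
have [sigma s0 /choice[gamma /choice[k /choice[l hl]]]] := hsplit.
have gI i : 0 < gamma i <= pi / 2 by have [] := hl i.
have sg i : 0 < sin (gamma i) by exact: sin_gt0_pihalf.
have d0 i : 0 < l i / sigma%:R by have [_ _ _ l0] := hl i; rewrite divr_gt0// ltr0n.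
(* The required raise [xi i + M] is at most [2 * M], so its bound on [eta i] becomes [M * a i]. *)
pose a i := 2 / (l i / sigma%:R).
have a0 i : 0 <= a i by rewrite divr_ge0// ltW.
pose B := \sum_i a i * expR (a i) / sin (gamma i).
have B0 : 0 <= B.
  by apply: sumr_ge0 => i _; rewrite divr_ge0 ?(ltW (sg i))// mulr_ge0// expR_ge0.
(* The 1 in [1 + B] pays for the damping, as [1 - expR (- M) <= M], and [B] for the boosts. Taking
   [delta = 1] makes [M <= 1], so that each boost is at most [expR (a i)]. *)
exists (1 + B), 1; split; [exact: ltr_pwDl|exact: ltr01|] => xi xi1.
set M := \big[Num.max/0]_(i < s) `|xi i|.
have M0 : 0 <= M by exact: bigmax_ge_id.
have M1 : M <= 1 by apply: bigmax_le => // i _; rewrite ler_norml.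
have xiM i : `|xi i| <= M by exact: le_bigmax.
have zM i : 0 <= xi i + M <= 2 * M.
  by have := xiM i; rewrite ler_norml => /andP[]; lra.
have /choice[eta heta] i : exists eta, 0 <= eta <= M * a i /\
    limn_esup (fun n => (n%:R^-1 * ln (enorm (x i n))
      + eta * ((ngood x i (gamma i) sigma n)%:R / n%:R))%:E)
    = (lyapunov_exponent (x i) + (xi i + M)%:E)%E.
  have [_ hr hg l0] := hl i; have /andP[z0 z2] := zM i.
  have [eta /andP[eta0 etaM] etaE] := exponent_shift s0 hr hg l0 z0.
  exists eta; rewrite eta0 (le_trans etaM)// /a mulrA ler_wpM2r//.
    by rewrite invr_ge0 ltW.
  by rewrite mulrC.
have eta0 i : 0 <= eta i by have [/andP[]] := heta i.
have etaM i : eta i <= M * a i by have [/andP[]] := heta i.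
pose g i n : R := (good x i (gamma i) sigma n)%:R.
have g01 i n : 0 <= g i n <= 1 by rewrite /g; case: good; rewrite ?lexx ?ler01.
pose d n i := expR (eta i * g i n - M).
have dn0 n i : d n i != 0 by rewrite lt0r_neq0// expR_gt0.
pose P n := eigenmx (fundmx x n) (d n).
have Pdist n v : (0 < n)%N -> enorm ((P n - 1%:M) *m v) <= (1 + B) * M * enorm v.
  move=> n0; rewrite mulmxBl mul1mx.
  (* Comparison with [expR (- M) *: v] isolates the damping common to all components; the rest
     involves only the boosted ones. *)
  have -> : P n *m v - v
      = (P n *m v - expR (- M) *: v) + (expR (- M) - 1) *: v.
    by rewrite scalerBl scale1r addrA subrK.
  have eM1 : expR (- M) <= 1 by rewrite expR_le1 oppr_le0.
  rewrite (le_trans (enormD _ _))// mulrDl mul1r mulrDl addrC lerD//.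
    rewrite enormZ ler_wpM2r ?enorm_ge0// ler0_norm ?subr_le0//.
    by have := expR_ge1Dx (- M); lra.
  rewrite (le_trans (eigenmx_dist (a := fun i => expR (eta i * g i n) - 1)
    v (Yu _ n0) gI _ _))// => [i|i|]; last 1 first.
  - rewrite ler_wpM2r ?enorm_ge0// (gtr0_norm (expR_gt0 _)).
    rewrite (@le_trans _ _ (1 * \sum_i M * (a i * expR (a i) / sin (gamma i))))//.
      apply: ler_pM; rewrite ?expR_ge0//.
        by apply: sumr_ge0 => i _; rewrite divr_ge0// ltW.
      apply: ler_sum => i _; rewrite mulrA ler_wpM2r ?invr_ge0 ?(ltW (sg i))//.
      have /andP[gi0 gi1] := g01 i n.
      have eg0 : 0 <= eta i * g i n by rewrite mulr_ge0.
      have ega : eta i * g i n <= M * a i.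
        by rewrite (le_trans _ (etaM i))// ler_piMr.
      rewrite ger0_norm ?subr_ge0 -?expR0 ?ler_expR//.
      (* This keeps the bound linear in [M]: with [t = eta i * g i n], [t <= M * a i] while
         [expR t <= expR (a i)]. *)
      rewrite expR0 (le_trans (expR_sub1_le _))// mulrA.
      apply: ler_pM; rewrite ?expR_ge0//.
      by rewrite ler_expR (le_trans ega)// ler_piMl.
    by rewrite mul1r -mulr_sumr mulrC.
  - by rewrite addrCA subrr addr0 -expRD addrC.
  - by rewrite /g /good; case: (_ <= _)%E => //; rewrite andbF mulr0 expR0 subrr eqxx.
exists P; split.
- split.
  + by move=> n n0; have [] := eigenmxV (Yu _ n0) (dn0 n).
  + apply: (@le_lt_trans _ _ ((1 + B) * M + 1)%:E); last exact: ltry.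
    have BM0 : 0 <= (1 + B) * M by rewrite mulr_ge0// addr_ge0.
    apply: norm_infty_le => [|n v n0]; first by rewrite addr_ge0.
    have -> : P n *m v = (P n - 1%:M) *m v + v.
      by rewrite mulmxBl mul1mx subrK.
    by rewrite (le_trans (enormD _ _))// mulrDl mul1r lerD2r Pdist.
  (* The inverse is diagonal in the same basis, with eigenvalues
     [expR M * expR (- (eta i * g i n))]: it is compared with [expR M], and the relative deviations
     are at most 1. *)
  + pose C := \sum_i (sin (gamma i))^-1.
    apply: (@le_lt_trans _ _ (expR M * C + expR M)%:E); last exact: ltry.
    have C0 : 0 <= C by apply: sumr_ge0 => i _; rewrite invr_ge0 ltW.
    apply: norm_infty_le => [|n v n0].
      by rewrite addr_ge0// ?mulr_ge0// expR_ge0.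
    have [_ ->] := eigenmxV (Yu _ n0) (dn0 n).
    set Q := eigenmx _ _.
    have -> : Q *m v = (Q *m v - expR M *: v) + expR M *: v by rewrite subrK.
    rewrite (le_trans (enormD _ _))// mulrDl lerD//; last first.
      by rewrite enormZ gtr0_norm ?expR_gt0.
    rewrite (le_trans (eigenmx_dist (a := fun i => expR (- (eta i * g i n)) - 1)
      v (Yu _ n0) gI _ _))// => [i|i|]; last 1 first.
    * rewrite ler_wpM2r ?enorm_ge0// (gtr0_norm (expR_gt0 _)).
      rewrite ler_wpM2l ?expR_ge0//; apply: ler_sum => i _.
      rewrite ler_piMl ?invr_ge0 ?(ltW (sg i))//.
      have /andP[gi0 gi1] := g01 i n.
      have : expR (- (eta i * g i n)) <= 1 by rewrite expR_le1 oppr_le0 mulr_ge0.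
      by have := expR_gt0 (- (eta i * g i n)); rewrite ler_norml; lra.
    * by rewrite addrCA subrr addr0 -expRN -expRD; congr expR; ring.
    * rewrite /g /good; case: (_ <= _)%E => //.
      by rewrite andbF mulr0 oppr0 expR0 subrr eqxx.
- apply: norm_infty_le => [|n v n0]; last exact: Pdist.
  by rewrite mulr_ge0// addr_ge0.
move=> xbar hbar i; have [bsol b1] := hbar i; have [_ etaE] := heta i.
apply: (exponent_scaled _ _ etaE) => n n0.
  (* A vanishing [x i n] would be a zero column of the invertible fundamental matrix. *)
  apply/eqP => xn0; have := Yu _ n0; rewrite unitmxE unitfE -det_tr => /det0P[].
  exists (delta_mx 0 i).
    by apply/eqP => /matrixP/(_ 0 i); rewrite !mxE !eqxx => /eqP; rewrite oner_eq0.
  by rewrite -rowE -tr_col col_fundmx xn0 trmx0.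
(* The induction starts at time 1, where [M - M * 1] and the empty [ngood] give the factor 1; each
   step multiplies by an eigenvalue. *)
case: n n0 => // n _; elim: n => [|n IHn].
  by rewrite b1 mulr1 subrr add0r /ngood big_geq// mulr0 expR0 scale1r.
have [xsol _] := hx.
rewrite bsol// IHn (xsol i n.+1)// -scalemxAr -mulmxA -(col_fundmx x).
rewrite eigenmx_col ?Yu//.
rewrite -scalemxAr scalerA -expRD; congr (expR _ *: _).
rewrite (ngoodS x i (gamma i) sigma (ltn0Sn n)) natrD -/(g i n.+1).
by rewrite -[n.+2%:R]natr1; ring.
Qed.
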